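(* Let $G$ be a signed eulerian graph with an odd number of negative edges. The following are equivalent: (a) $G$ admits a nowhere-zero integer flow; (b) $G$ admits a nowhere-zero $4$-flow; (c) $G$ contains two edge-disjoint unbalanced circuits; (d) $G$ is the union of two eulerian subgraphs each having an even number of negative edges; (e) $G$ can be decomposed into three edge-disjoint eulerian subgraphs each having an odd number of negative edges.
   Context: Graphs are finite and may have loops and multiple edges. A graph is eulerian if it is connected and every vertex has even valency. A signed graph is a graph with a signature $\sigma:E\to\{+1,-1\}$; a circuit (connected 2-regular subgraph) is unbalanced if it contains an odd number of negative edges. Orientation: each edge has two half-edges; positive edges have exactly one half-edge pointing toward its end, negative edges have both pointing away or both toward their ends. A $\mathbb{Z}$-flow is $\xi:E\to\mathbb{Z}$ such that at each vertex the sum of values on half-edges directed out minus the sum on half-edges directed in is $0$; nowhere-zero means no value $0$; a nowhere-zero $k$-flow takes values in $\{\pm1,\dots,\pm(k-1)\}$. *)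

(* Defs.v *)
From HB Require Import structures.
From mathcomp Require Import all_boot all_order all_algebra.

Set Implicit Arguments.
Unset Strict Implicit.
Unset Printing Implicit Defensive.

Import GRing.Theory Num.Theory.
Local Open Scope ring_scope.

(* An edge [e] has the two half-edges [(e, false)] and [(e, true)]; the half-edge
   [h] is attached to the vertex [hend h].  The order of the two halves carries
   no information.  A loop is an edge whose halves have the same end, and
   parallel edges are allowed.  [neg e] encodes the signature: the sign of [e] is
   -1 if [neg e] holds and +1 otherwise. *)
Record sgraph := SGraph {
  vertex : finType;
  edge : finType;
  hend : edge * bool -> vertex;
  neg : pred edge
}.

Definition half_edge (G : sgraph) : finType := (edge G * bool)%type.

(* A subgraph may contain isolated vertices. *)
Record subgraph (G : sgraph) := Subgraph {
  vset : {set vertex G};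
  eset : {set edge G};
  subgraph_closed :
    [forall e in eset, forall b : bool, hend (e, b) \in vset]
}.

Lemma full_closed (G : sgraph) :
  [forall e in [set: edge G], forall b : bool,
    hend (e, b) \in [set: vertex G]].
Proof. by apply/forall_inP => e _; apply/forallP => b; rewrite inE. Qed.

Definition full (G : sgraph) : subgraph G := Subgraph (full_closed G).

Definition half_edges_at (G : sgraph) (H : subgraph G) (v : vertex G) :
    {set half_edge G} :=
  [set h | (h.1 \in eset H) && (hend h == v)].

(* a loop contributes 2 *)
Definition valency (G : sgraph) (H : subgraph G) (v : vertex G) : nat :=
  #|half_edges_at H v|.

Definition adjacent (G : sgraph) (H : subgraph G) : rel (vertex G) :=
  fun u v => [exists e in eset H, exists b : bool,
    (hend (e, b) == u) && (hend (e, ~~ b) == v)].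

(* The graph without vertices is not regarded as connected. *)
Definition connected (G : sgraph) (H : subgraph G) : Prop :=
  vset H != set0 /\ {in vset H &, forall u v, connect (adjacent H) u v}.

Definition eulerian (G : sgraph) (H : subgraph G) : Prop :=
  connected H /\ {in vset H, forall v, ~~ odd (valency H v)}.

Definition circuit (G : sgraph) (H : subgraph G) : Prop :=
  connected H /\ {in vset H, forall v, valency H v = 2%N}.

Definition num_neg (G : sgraph) (H : subgraph G) : nat :=
  #|[set e in eset H | neg e]|.

Definition unbalanced_circuit (G : sgraph) (H : subgraph G) : Prop :=
  circuit H /\ odd (num_neg H).

Definition edge_disjoint (G : sgraph) (H1 H2 : subgraph G) : Prop :=
  [disjoint eset H1 & eset H2].

(* [o h] means that the half-edge [h] points toward its end [hend h]; hence
   [~~ o h] means that [h] is directed out of [hend h]. *)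
Definition orientation (G : sgraph) (o : half_edge G -> bool) : Prop :=
  forall e : edge G,
    if neg e then o (e, false) = o (e, true) else o (e, false) <> o (e, true).

Definition is_flow (G : sgraph) (o : half_edge G -> bool) (xi : edge G -> int) :
    Prop :=
  forall v : vertex G,
    \sum_(h in half_edges_at (full G) v | ~~ o h) xi h.1
    - \sum_(h in half_edges_at (full G) v | o h) xi h.1 = 0.

Definition has_nowhere_zero_flow (G : sgraph) : Prop :=
  exists (o : half_edge G -> bool) (xi : edge G -> int),
    [/\ orientation o, is_flow o xi & forall e, xi e != 0].

Definition has_nowhere_zero_kflow (G : sgraph) (k : nat) : Prop :=
  exists (o : half_edge G -> bool) (xi : edge G -> int),
    [/\ orientation o, is_flow o xi & forall e, 0 < `|xi e| < k%:Z].

(* Main.v *)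
Require Import Defs.
From Stdlib Require Import Classical_Prop.
From mathcomp Require Import all_boot all_order all_algebra.
From mathcomp Require Import zify.

(* All conditions are compared with the existence of two edge-disjoint odd closed
   trails (a trail is odd if it has an odd number of negative edges).

   From a flow to two odd trails: suppose that there are none. Write an Euler
   trail as [a] followed by [b], both closed at a common vertex, with [a] odd and
   as short as possible. By minimality closed segments of [a] are even, and so are
   those of [b], which are disjoint from [a]. Let [e] be the edge of [a] following
   the last visit of [a] to a vertex of [b] where the parities along [a] and along
   [b] agree. Then every closed segment of the Euler trail that avoids [e] is even,
   so deleting [e] leaves a balanced graph, and the conservation laws, weighted by
   a switching that makes this graph all-positive, give [2 * xi e = 0].

   From two odd trails to three: take them with maximal total length. Every
   component of the remaining edges touches one of the two and is odd, since an
   even one could be absorbed; for the same reason no two components touch the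
   same trail. Hence by parity there is exactly one component.

   Of three odd trails covering the graph, one touches both others. Joining it to
   either one gives two even trails that cover the graph; these carry flows [f1]
   and [f2] with values 1 and -1, and [f1 + 2 f2] is a nowhere-zero 4-flow. *)

Set Implicit Arguments.
Unset Strict Implicit.
Unset Printing Implicit Defensive.

(** * Walks, closed trails, and trails inside edge sets with all degrees even *)

Section Walks.
Context {G : sgraph}.
Implicit Types (x y z v : vertex G) (h : half_edge G) (p q r : seq (half_edge G)).
Implicit Types (S T : {set edge G}).

Definition flip h : half_edge G := (h.1, ~~ h.2).

(* The half-edge [h] stands for its edge traversed away from [hend h]. *)
Fixpoint walk x p y : bool :=
  if p is h :: q then (hend h == x) && walk (hend (flip h)) q y else x == y.

Definition edges p : seq (edge G) := [seq h.1 | h <- p].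

Definition verts x p : seq (vertex G) := x :: [seq hend (flip h) | h <- p].

Definition parity p : bool := odd (count (fun h => neg h.1) p).

Definition ctrail x p : bool := walk x p x && uniq (edges p).

Lemma flipK : involutive flip.
Proof. by case=> e b; rewrite /flip /= negbK. Qed.

Lemma walk_cat x p z q y : walk x p z -> walk x (p ++ q) y = walk z q y.
Proof.
by elim: p x => [|h p IHp] x /= => [/eqP->|/andP[->]] //; apply: IHp.
Qed.

Lemma walk_split x p q y :
  walk x (p ++ q) y -> exists2 z, walk x p z & walk z q y.
Proof.
elim: p x => [|h p IHp] x /=; first by exists x.
by case/andP=> -> /IHp.
Qed.

Lemma walk_inj x p y z : walk x p y -> walk x p z -> y = z.
Proof.
by elim: p x => [|h p IHp] x /= => [/eqP<- /eqP|/andP[_ Hy] /andP[_]] //; apply: IHp Hy.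
Qed.

Lemma walk_rev x p y : walk x p y -> walk y (rev (map flip p)) x.
Proof.
elim: p x => [|h p IHp] x /=; first by rewrite eq_sym.
case/andP=> /eqP hx /IHp wp; rewrite rev_cons -cats1 (walk_cat _ _ wp) /=.
by rewrite !eqxx flipK hx eqxx.
Qed.

Lemma edges_cat p q : edges (p ++ q) = edges p ++ edges q.
Proof. exact: map_cat. Qed.

Lemma edges_rev p : edges (rev (map flip p)) = rev (edges p).
Proof. by rewrite /edges map_rev -map_comp. Qed.

Lemma parity_cat p q : parity (p ++ q) = parity p (+) parity q.
Proof. by rewrite /parity count_cat oddD. Qed.

Lemma parity_cons h p : parity (h :: p) = neg h.1 (+) parity p.
Proof. by rewrite /parity /= oddD oddb. Qed.

Lemma parity_rev p : parity (rev (map flip p)) = parity p.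
Proof. by rewrite /parity count_rev count_map. Qed.

Lemma vertsP x p y v :
  walk x p y -> v \in verts x p ->
  exists p1 p2, [/\ p = p1 ++ p2, walk x p1 v & walk v p2 y].
Proof.
elim: p x => [|h p IHp] x /=.
  by move=> /eqP<-; rewrite inE => /eqP->; exists [::], [::]; rewrite /= eqxx.
case/andP=> hx wp; rewrite in_cons => /orP[/eqP->|].
  by exists [::], (h :: p); rewrite /= eqxx hx.
case/(IHp _ wp)=> p1 [p2 [-> w1 w2]].
by exists (h :: p1), p2; rewrite /= hx.
Qed.

Lemma edge_verts x p y e b :
  walk x p y -> e \in edges p -> hend (e, b) \in verts x p.
Proof.
elim: p x => [|h p IHp] x //= /andP[/eqP hx wp].
rewrite /edges /= in_cons => /orP[/eqP->|/(IHp _ wp)].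
  rewrite /verts /= !in_cons; case: h hx {wp IHp} => e' b' /= <-.
  by case: b b' => [] []; rewrite ?eqxx ?orbT.
by rewrite /verts /= => ev; rewrite in_cons ev orbT.
Qed.

Lemma half_edge_verts x p y h :
  walk x p y -> h.1 \in edges p -> hend h \in verts x p.
Proof. by case: h => e b; apply: edge_verts. Qed.

Definition half_degree S v : nat :=
  #|[set h : half_edge G | (h.1 \in S) && (hend h == v)]|.

Lemma half_degreeE S v :
  half_degree S v = \sum_(e in S) ((hend (e, true) == v) + (hend (e, false) == v)).
Proof.
rewrite /half_degree -sum1_card.
transitivity (\sum_(e in S) \sum_(b | hend (e, b) == v) 1).
  by rewrite pair_big_dep /=; apply: eq_bigl => -[e b]; rewrite inE.
apply: eq_bigr => e _; rewrite big_mkcond big_bool.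
by case: eqP; case: eqP.
Qed.

Lemma half_degreeD S T v :
  S \subset T -> half_degree T v = half_degree S v + half_degree (T :\: S) v.
Proof.
move=> /setIidPr sST; rewrite !half_degreeE (big_setID S) /=; congr (_ + _).
by rewrite sST.
Qed.

Lemma half_degree_edges p v : uniq (edges p) ->
  half_degree [set e in edges p] v =
  count (fun h => hend h == v) p + count (fun h => hend (flip h) == v) p.
Proof.
move=> up; rewrite half_degreeE.
rewrite (eq_bigl [in edges p]) => [|e]; last by rewrite inE.
rewrite -big_uniq //= big_map -!sum1_count !(big_mkcond (fun h => hend _ == v)).
rewrite -big_split; apply: eq_bigr => -[e []] _ /=; do 2!case: eqP => //.
Qed.

Lemma walk_count x p y v : walk x p y ->
  count (fun h => hend h == v) p + (y == v) =
  count (fun h => hend (flip h) == v) p + (x == v).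
Proof.
elim: p x => [|h p IHp] x /= => [/eqP-> //|/andP[/eqP<- /IHp IH]].
by rewrite -addnA IH addnC (addnC (hend (flip h) == v)).
Qed.

(** A closed trail arrives at each vertex as often as it departs from it, so counting departures
    suffices. *)
Lemma half_degree_ctrail x p v : ctrail x p ->
  half_degree [set e in edges p] v = (count (fun h => hend h == v) p).*2.
Proof.
case/andP=> wp up; rewrite half_degree_edges // -addnn.
by have /eqP := walk_count v wp; rewrite eqn_add2r => /eqP<-.
Qed.

Definition even_set T := forall v, ~~ odd (half_degree T v).

Lemma even_ctrail x p : ctrail x p -> even_set [set e in edges p].
Proof. by move=> cp v; rewrite (half_degree_ctrail _ cp) odd_double. Qed.

Lemma even_setD S T : S \subset T -> even_set S -> even_set T -> even_set (T :\: S).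
Proof.
move=> sST eS eT v; have := eT v; rewrite (half_degreeD _ sST) oddD.
by rewrite (negbTE (eS v)).
Qed.

Lemma sub_edges p T : {subset edges p <= T} <-> [set e in edges p] \subset T.
Proof.
split=> [sp|/subsetP sp e ep]; first by apply/subsetP => e; rewrite inE => /sp.
by apply: sp; rewrite inE.
Qed.

Lemma size_edges_le p T : uniq (edges p) -> {subset edges p <= T} -> size p <= #|T|.
Proof.
move=> up sp; rewrite -(size_map (fun h => h.1)) -/(edges p) cardE.
by apply: uniq_leq_size => // e /sp; rewrite mem_enum.
Qed.

Lemma trail_close T x p y :
  even_set T -> walk x p y -> uniq (edges p) -> {subset edges p <= T} ->
  exists q, ctrail x (p ++ q) /\ {subset edges (p ++ q) <= T}.
Proof.
move=> eT; have [n] := ubnP (#|T| - size p).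
elim: n p y => // n IHn p y Dn wp up sp.
have [yx|nyx] := eqVneq y x.
  by exists [::]; rewrite cats0 /ctrail -{2}yx wp up.
have /card_gt0P[h] : 0 < half_degree (T :\: [set e in edges p]) y.
  rewrite lt0n; apply/eqP => d0; have := eT y.
  rewrite (half_degreeD _ (proj1 (sub_edges _ _) sp)) d0 addn0.
  rewrite half_degree_edges //; have := walk_count y wp.
  rewrite eqxx eq_sym (negbTE nyx) addn0 addn1 => <-.
  by rewrite addnS /= addnn odd_double.
rewrite !inE => /andP[/andP[hp hT] /eqP hy].
have sp' : {subset edges (rcons p h) <= T}.
  by move=> e; rewrite -cats1 edges_cat mem_cat inE => /orP[/sp //|/eqP->].
have up' : uniq (edges (rcons p h)).
  by rewrite -cats1 edges_cat cats1 rcons_uniq hp.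
have wp' : walk x (rcons p h) (hend (flip h)).
  by rewrite -cats1 (walk_cat _ _ wp) /= hy !eqxx.
have := size_edges_le up' sp'; rewrite size_rcons => lt_p.
have [|q] := IHn _ _ _ wp' up' sp'; last first.
  by rewrite cat_rcons => Hq; exists (h :: q).
by rewrite size_rcons -ltnS (leq_trans _ Dn) // ltnS ltn_sub2l.
Qed.

Lemma ctrail_insert x p1 p2 y q :
  walk x p1 y -> walk y p2 x -> uniq (edges (p1 ++ p2)) -> ctrail y q ->
  {in edges q, forall e, e \notin edges (p1 ++ p2)} ->
  ctrail x (p1 ++ q ++ p2).
Proof.
move=> w1 w2 u12 /andP[wq uq] dq; apply/andP; split.
  by rewrite (walk_cat _ _ w1) (walk_cat _ _ wq).
rewrite !edges_cat (perm_uniq (permEl (perm_catCA _ _ _))) cat_uniq uq -edges_cat.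
by rewrite u12 andbT; apply/hasPn => e ep; apply: contraL ep => /dq.
Qed.

Lemma component T x : even_set T ->
  exists p, [/\ ctrail x p, {subset edges p <= T} &
    forall h, h.1 \in T -> h.1 \notin edges p -> hend h \notin verts x p].
Proof.
move=> eT.
suff H p n : #|T| - size p < n -> ctrail x p -> {subset edges p <= T} ->
    exists p, [/\ ctrail x p, {subset edges p <= T} &
      forall h, h.1 \in T -> h.1 \notin edges p -> hend h \notin verts x p].
  by apply: (H [::] _ (ltnSn _)); rewrite // /ctrail /= eqxx.
elim: n p => // n IHn p Dn cp sp.
have [h /and3P[hT hp hv]|none] :=
  pickP (fun h => [&& h.1 \in T, h.1 \notin edges p & hend h \in verts x p]).
  have /andP[wp up] := cp; have [p1 [p2 [Dp w1 w2]]] := vertsP wp hv.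
  have e' := even_setD (proj1 (sub_edges _ _) sp) (even_ctrail cp) eT.
  have [|||q [cq sq]] := @trail_close _ (hend h) [:: h] (hend (flip h)) e';
    rewrite //= ?eqxx //.
    by move=> e; rewrite inE => /eqP->; rewrite !inE hp.
  have cr : ctrail x (p1 ++ (h :: q) ++ p2).
    apply: ctrail_insert w1 w2 _ cq _; rewrite -Dp // => e /sq.
    by rewrite !inE => /andP[].
  have sr : {subset edges (p1 ++ (h :: q) ++ p2) <= T}.
    move=> e; rewrite !edges_cat !mem_cat => /or3P[ep|/sq|ep].
    - by apply: sp; rewrite Dp edges_cat mem_cat ep.
    - by rewrite inE => /andP[].
    - by apply: sp; rewrite Dp edges_cat mem_cat ep orbT.
  have lt_sz : size p < size (p1 ++ (h :: q) ++ p2).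
    by rewrite Dp !size_cat /= addSn addnS ltnS leq_add2l leq_addl.
  apply: (IHn _ _ cr sr); rewrite -ltnS (leq_trans _ Dn) // ltnS ltn_sub2l //.
  by apply: leq_trans lt_sz (size_edges_le (proj2 (andP cr)) sr).
exists p; split=> // h hT hp; have := none h; by rewrite hT hp /= => ->.
Qed.

End Walks.

(** * Passing between closed trails and eulerian subgraphs or circuits *)

Section Subgraphs.
Context {G : sgraph}.
Implicit Types (x y z u v : vertex G) (h : half_edge G) (p q r : seq (half_edge G)).
Implicit Types (S T : {set edge G}) (H : subgraph G).

Lemma hend_vset H h : h.1 \in eset H -> hend h \in vset H.
Proof.
by case: h => e b /= eH; have /forall_inP/(_ e eH)/forallP := subgraph_closed H.
Qed.

Lemma walk_connect H x p y :
  walk x p y -> {subset edges p <= eset H} -> connect (adjacent H) x y.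
Proof.
elim: p x => [|h p IHp] x /= => [/eqP-> //|/andP[/eqP<- wp] sp].
apply: connect_trans (IHp _ wp _); last by move=> e ep; apply: sp; rewrite inE ep orbT.
apply/connect1/existsP; exists h.1; rewrite sp ?inE ?eqxx //=.
by apply/existsP; exists h.2; rewrite -surjective_pairing !eqxx.
Qed.

(** Lying on the walk is invariant under adjacency: an edge of [H] is either traversed, with both
    ends on the walk, or has no end on it. *)
Lemma isolated_walk_verts H x p :
  connected H -> x \in vset H -> walk x p x ->
  (forall h, h.1 \in eset H -> h.1 \notin edges p -> hend h \notin verts x p) ->
  {subset vset H <= verts x p}.
Proof.
case=> _ cH xH wp isol v vH.
have cl u w : adjacent H u w -> (u \in verts x p) = (w \in verts x p).
  case/existsP=> f /andP[fH /existsP[b /andP[/eqP<- /eqP<-]]].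
  have [fp|fp] := boolP (f \in edges p); first by rewrite !(edge_verts _ wp fp).
  by rewrite (negbTE (isol (f, b) _ _)) // (negbTE (isol (f, ~~ b) _ _)).
by rewrite -(closed_connect cl (cH _ _ xH vH)) mem_head.
Qed.

Lemma isolated_walk_edges H x p :
  connected H -> x \in vset H -> walk x p x ->
  (forall h, h.1 \in eset H -> h.1 \notin edges p -> hend h \notin verts x p) ->
  {subset eset H <= edges p}.
Proof.
move=> cH xH wp isol e eH; apply/negPn/negP => ep.
have := isolated_walk_verts cH xH wp isol (@hend_vset H (e, true) eH).
by rewrite (negbTE (isol (e, true) _ _)).
Qed.

(** Euler's theorem: by connectedness, the closed trail covering the component of one vertex covers
    all edges. *)
Lemma euler_ctrail H :
  eulerian H -> exists x p, [/\ ctrail x p, x \in vset H & edges p =i eset H].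
Proof.
case=> cH eH; have [/set0Pn[x xH] _] := cH.
have [|p [cp sp isol]] := @component G (eset H) x.
  move=> v; have [/eH //|nv] := boolP (v \in vset H).
  rewrite (_ : half_degree _ _ = 0) //; apply/eqP; rewrite cards_eq0.
  apply/eqP/setP => h; rewrite !inE; apply/negbTE/negP => /andP[hH /eqP hv].
  by rewrite -hv hend_vset in nv.
exists x, p; split=> // e; apply/idP/idP; first exact: sp.
by have [wp _] := andP cp; apply: (isolated_walk_edges cH xH wp isol).
Qed.

Lemma odd_num_neg H p :
  uniq (edges p) -> edges p =i eset H -> odd (num_neg H) = parity p.
Proof.
move=> up pH; rewrite /num_neg -sum1_card.
rewrite (eq_bigl (fun e => (e \in edges p) && neg e)) => [|e]; last by rewrite inE pH.
by rewrite big_mkcondr -big_uniq //= big_map -big_mkcond sum1_count.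
Qed.

Definition support S : {set vertex G} :=
  [set v | [exists h : half_edge G, (h.1 \in S) && (hend h == v)]].

Lemma support_closed S :
  [forall e in S, forall b : bool, hend (e, b) \in support S].
Proof.
apply/forall_inP => e eS; apply/forallP => b; rewrite inE.
by apply/existsP; exists (e, b); rewrite eS eqxx.
Qed.

(** Only the ends of edges in [S] are taken as vertices, so no isolated vertex can spoil
    connectedness. *)
Definition edge_subgraph S : subgraph G := Subgraph (support_closed S).

Lemma parity_nonempty p : parity p -> p != [::].
Proof. by case: p. Qed.

Lemma verts_half_edge x p v : walk x p x -> p != [::] -> v \in verts x p ->
  exists2 h, h.1 \in edges p & hend h = v.
Proof.
case: p => // h p wp _; rewrite in_cons => /orP[/eqP->|/mapP[h' hp ->]].
  by exists h; rewrite ?inE ?eqxx //; case/andP: wp => /eqP.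
by exists (flip h') => //; apply: (map_f (fun h => h.1) hp).
Qed.

Lemma support_edges x p : ctrail x p -> p != [::] ->
  support [set e in edges p] =i verts x p.
Proof.
case/andP=> wp _ pp v; rewrite inE; apply/existsP/idP => [[[e b]]|].
  by rewrite inE => /andP[ep /eqP<-]; apply: edge_verts wp ep.
by case/(verts_half_edge wp pp)=> h hp <-; exists h; rewrite inE hp eqxx.
Qed.

Lemma ctrail_connected x p :
  ctrail x p -> p != [::] -> connected (edge_subgraph [set e in edges p]).
Proof.
move=> cp pp; have suppE := support_edges cp pp; have /andP[wp _] := cp.
split=> [|u v]; first by apply/set0Pn; exists x; rewrite suppE inE eqxx.
rewrite !suppE => /(vertsP wp)[p1 [p2 [Dp _ w2]]] /(vertsP wp)[q1 [q2 [Dq w1 _]]].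
apply: (connect_trans (y := x)); [apply: walk_connect w2 _|apply: walk_connect w1 _].
  by move=> e ep; rewrite inE Dp edges_cat mem_cat ep orbT.
by move=> e ep; rewrite inE Dq edges_cat mem_cat ep.
Qed.

Lemma eulerian_ctrail x p :
  ctrail x p -> p != [::] -> eulerian (edge_subgraph [set e in edges p]).
Proof.
move=> cp pp; split=> [|v _]; first exact: ctrail_connected cp pp.
exact: even_ctrail cp v.
Qed.

(** A closed trail that repeats a vertex splits there into two shorter closed trails. Their parities
    add up to odd, so one of them is odd, and induction applies to it. *)
Lemma odd_ctrail_circuit x p : ctrail x p -> parity p ->
  exists C, unbalanced_circuit C /\ {subset eset C <= edges p}.
Proof.
have [n] := ubnP (size p); elim: n x p => // n IHn x p szp cp pp.
have /andP[wp up] := cp; have p0 := parity_nonempty pp.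
(* If no vertex is departed from twice, every vertex of the trail has valency exactly 2. *)
have [uv|nuv] := boolP (uniq [seq hend h | h <- p]).
  exists (edge_subgraph [set e in edges p]); split; last by move=> e; rewrite inE.
  split; last by rewrite (odd_num_neg up) // => e; rewrite inE.
  split=> [|v vp]; first exact: ctrail_connected cp p0.
  rewrite /valency -/(half_degree _ _) (half_degree_ctrail _ cp).
  have := count_uniq_mem v uv; rewrite count_map => ->.
  suff -> : v \in [seq hend h | h <- p] by [].
  have [p1 [p2 [Dp w1 w2]]] : exists p1 p2, [/\ p = p1 ++ p2, walk x p1 v & walk v p2 x].
    by apply: vertsP wp _; rewrite -(support_edges cp p0).
  case: p2 Dp w2 => [|h q] Dp.
    move/eqP=> vx; case: p pp {IHn p0 szp cp wp up uv vp Dp} (wp) => // h q _ /=.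
    by rewrite vx => /andP[/eqP-> _]; rewrite mem_head.
  by rewrite Dp map_cat mem_cat inE /= => /andP[/eqP->]; rewrite eqxx orbT.
have [p1 [h1 [p2 [h2 [p3 [Dp hh]]]]]] : exists p1 h1 p2 h2 p3,
    p = p1 ++ (h1 :: p2) ++ h2 :: p3 /\ hend h1 = hend h2.
  elim: (p) nuv => // h q IHq /=; rewrite negb_and negbK.
  case: (boolP (hend h \in _)) => [/mapP[h2 /splitPr[q1 q2] hh] _|_ /= /IHq].
    by exists [::], h, q1, h2, q2.
  by case=> p1 [h1 [p2 [h2 [p3 [-> hh]]]]]; exists (h :: p1), h1, p2, h2, p3.
move: wp up pp szp; rewrite {p0}Dp => wp.
have [y w1 w23] := walk_split wp; have [z w2 w3] := walk_split w23.
have yz : y = z.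
  by move: w2 w3 => /= /andP[/eqP<- _] /andP[/eqP<- _].
subst z; rewrite !edges_cat uniq_catCA cat_uniq => /and3P[u2 _ u13].
rewrite !parity_cat addbCA -parity_cat => pp szp.
have [odd2|even2] := boolP (parity (h1 :: p2)).
  have [|||C [uC sC]] := IHn y (h1 :: p2); rewrite /ctrail ?w2 ?u2 //.
    rewrite -ltnS (leq_trans _ szp) // ltnS !size_cat /= !addSn !addnS !ltnS.
    by rewrite addnCA leq_addr.
  exists C; split=> // e /sC ep.
  by rewrite !mem_cat ep orbT.
have [|||C [uC sC]] := IHn x (p1 ++ h2 :: p3).
- rewrite -ltnS (leq_trans _ szp) // ltnS !size_cat /= !addSn !addnS !ltnS.
  by rewrite leq_add2l leq_addl.
- by rewrite /ctrail (walk_cat _ _ w1) w3 edges_cat.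
- by rewrite (negbTE even2) in pp.
exists C; split=> // e /sC; rewrite edges_cat !mem_cat => /orP[->|->] //.
by rewrite !orbT.
Qed.

End Subgraphs.

(** * From two disjoint odd closed trails to three that cover the graph, and to two even ones *)

Section Decomposition.
Context {G : sgraph}.
Implicit Types (x y z u v : vertex G) (h : half_edge G) (p q r d l s : seq (half_edge G)).

Lemma perm_edges p q : perm_eq p q -> perm_eq (edges p) (edges q).
Proof. exact: perm_map. Qed.

Lemma parity_perm p q : perm_eq p q -> parity p = parity q.
Proof. by move=> /permP pq; rewrite /parity pq. Qed.

Definition touch x p y q : bool := has [in verts x p] (verts y q).

Lemma touch_sym x p y q : touch x p y q = touch y q x p.
Proof. exact: has_sym. Qed.

(** Rotate [q] so that it starts at a shared vertex, and insert it into [p] there. *)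
Lemma walk_join x p y q : walk x p x -> walk y q y -> touch x p y q ->
  exists r, walk x r x /\ perm_eq r (p ++ q).
Proof.
move=> wp wq /hasP[v vq vp].
have [p1 [p2 [-> w1 w2]]] := vertsP wp vp.
have [q1 [q2 [-> w3 w4]]] := vertsP wq vq.
exists (p1 ++ (q2 ++ q1) ++ p2); split.
  by rewrite (walk_cat _ _ w1) -catA (walk_cat _ _ w4) (walk_cat _ _ w3).
by rewrite -(catA p1 p2) perm_cat2l perm_catC perm_cat2l perm_catC.
Qed.

Definition odd_pair x p y q : bool :=
  [&& walk x p x, walk y q y, uniq (edges (p ++ q)), parity p & parity q].

Definition larger_odd_pair p q : Prop :=
  exists x' p' y' q', odd_pair x' p' y' q' /\ size p + size q < size p' + size q'.

Lemma odd_pair_sym x p y q : odd_pair x p y q = odd_pair y q x p.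
Proof.
rewrite /odd_pair !edges_cat uniq_catC andbCA.
by rewrite [parity p && _]andbC.
Qed.

(** Replacing [p] by [r] keeps the parity odd and adds length. [s] is only a list of half-edges, so
    it may also consist of two closed trails, as in [join_two_odd]. *)
Lemma odd_pair_grow x p y q r s :
  odd_pair x p y q -> walk x r x -> perm_eq r (p ++ s) ->
  uniq (edges (p ++ q ++ s)) -> ~~ parity s -> s != [::] -> larger_odd_pair p q.
Proof.
case/and5P=> wp wq _ pp pq wr rps u ps s0; exists x, r, y, q.
rewrite /odd_pair wr wq (parity_perm rps) parity_cat pp pq (negbTE ps).
have -> : uniq (edges (r ++ q)).
  rewrite (perm_uniq (perm_edges (_ : perm_eq (r ++ q) (p ++ q ++ s)))) //.
  by rewrite perm_sym perm_catCA perm_sym perm_catC perm_cat2l.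
by rewrite (perm_size rps) size_cat addnAC -[X in X < _]addn0 ltn_add2l lt0n size_eq0.
Qed.

Lemma larger_odd_pairC p q : larger_odd_pair p q -> larger_odd_pair q p.
Proof. by rewrite /larger_odd_pair addnC. Qed.

Lemma join_even x p y q z l :
  odd_pair x p y q -> walk z l z -> uniq (edges (p ++ q ++ l)) -> ~~ parity l ->
  l != [::] -> touch x p z l || touch y q z l -> larger_odd_pair p q.
Proof.
move=> opq wl u pl l0 /orP[tl|tl]; have /and5P[wp wq _ _ _] := opq.
  by have [r [wr rpl]] := walk_join wp wl tl; apply: odd_pair_grow opq wr rpl _ _ _.
have [r [wr rpl]] := walk_join wq wl tl.
rewrite odd_pair_sym in opq; apply/larger_odd_pairC.
apply: odd_pair_grow opq wr rpl _ _ _ => //.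
rewrite (perm_uniq (perm_edges (_ : perm_eq _ (p ++ q ++ l)))) //.
by rewrite perm_catCA.
Qed.

(** Two odd trails together are even, so attaching both to [p] leaves it odd. *)
Lemma join_two_odd x p y q z l z' l' :
  odd_pair x p y q -> walk z l z -> walk z' l' z' ->
  uniq (edges (p ++ q ++ l ++ l')) -> parity l -> parity l' ->
  touch x p z l -> touch x p z' l' -> larger_odd_pair p q.
Proof.
move=> opq wl wl' u pl pl' tl tl'; have /and5P[wp _ _ _ _] := opq.
have [r [wr rpl]] := walk_join wp wl tl.
(* [l'] still touches [r]: since [p] is nonempty, the shared vertex is an end of an edge of [p], and
   this edge lies on [r]. *)
have [|r' [wr' rpl']] := walk_join wr wl' _.
  case/hasP: tl' => v vl' vp; apply/hasP; exists v => //.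
  have p0 : p != [::] by have /and5P[_ _ _ /parity_nonempty] := opq.
  have [h hp <-] := verts_half_edge wp p0 vp.
  apply: half_edge_verts wr _.
  by rewrite (perm_mem (perm_edges rpl)) edges_cat mem_cat hp.
apply: (odd_pair_grow (s := l ++ l') opq wr').
- by rewrite (perm_trans rpl') // catA perm_cat2r.
- by [].
- by rewrite parity_cat pl pl'.
- by case: (l) pl.
Qed.

Definition even_rest s := even_set (~: [set e in edges s]).

Lemma edges_rest s l : ~: [set e in edges (s ++ l)] =
  ~: [set e in edges s] :\: [set e in edges l].
Proof. by apply/setP => e; rewrite !inE edges_cat mem_cat negb_or andbC. Qed.

Lemma even_rest_cat s z l : even_rest s -> ctrail z l -> uniq (edges (s ++ l)) ->
  even_rest (s ++ l).
Proof.
move=> es cl u v; rewrite edges_rest; apply: even_setD v => //; last exact: even_ctrail cl.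
apply/subsetP => e; rewrite !inE; move: u; rewrite edges_cat cat_uniq.
by case/and3P=> _ /hasPn dsl _ /dsl.
Qed.

(** For [d] disjoint from [s], this says that [d] is a union of whole components of the graph formed
    by the edges outside [s]. *)
Definition saturated s d : Prop := forall h h',
  h.1 \in edges d -> h'.1 \notin edges (s ++ d) -> hend h != hend h'.

Hypothesis Gconn : connected (full G).

(** Otherwise the walk would be isolated and, [G] being connected, would contain every edge. *)
Lemma ctrail_exit x p e : walk x p x -> e \notin edges p ->
  exists2 h, h.1 \notin edges p & hend h \in verts x p.
Proof.
move=> wp ep.
have [h /andP[hp hv]|none] := pickP (fun h => (h.1 \notin edges p) && (hend h \in verts x p)).
  by exists h.
have := @isolated_walk_edges G (full G) x p Gconn (in_setT _) wp _ e (in_setT _).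
case/(_ _)/idPn => // h _ hp; apply/negP => hv; have := none h; by rewrite hp hv.
Qed.

(** Take for [l] the component of [h] among the uncovered edges. Since [l] misses the edges of [p],
    some edge outside [l] meets it. That edge is not uncovered, as [l] is a whole component, and not
    in [d], which is saturated; so it belongs to [p] or [q]. *)
Lemma next_component x p y q d h :
  odd_pair x p y q -> uniq (edges ((p ++ q) ++ d)) -> even_rest ((p ++ q) ++ d) ->
  saturated (p ++ q) d -> h.1 \notin edges ((p ++ q) ++ d) ->
  exists z l, [/\ walk z l z, uniq (edges ((p ++ q) ++ d ++ l)),
    even_rest ((p ++ q) ++ d ++ l), saturated (p ++ q) (d ++ l) &
    l != [::] /\ touch x p z l || touch y q z l].
Proof.
move=> opq u ev sat hd; have [l [cl sl isol]] := component (hend h) ev.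
have [wl ul] := andP cl.
have hl : h.1 \in edges l.
  by apply/negPn/negP => /(isol h); rewrite inE inE hd mem_head => /(_ isT).
have u' : uniq (edges (((p ++ q) ++ d) ++ l)).
  rewrite edges_cat cat_uniq u ul andbT; apply/hasPn => e /sl.
  by rewrite !inE.
have l0 : l != [::] by case: (l) hl.
exists (hend h), l; split; rewrite ?[(p ++ q) ++ _ ++ _]catA //.
- exact: even_rest_cat cl u'.
- move=> h1 h2; rewrite edges_cat mem_cat catA edges_cat mem_cat negb_or.
  case/orP=> [h1d|h1l] /andP[h2d h2l]; first exact: sat.
  apply: contraNneq (isol h2 _ h2l) => [<-|]; last by rewrite !inE.
  exact: half_edge_verts wl h1l.
split=> //; have [e ep] : exists e, e \in edges p.
  have /and5P[_ _ _] := opq; case: (p) => // h0 p0 _ _.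
  by exists h0.1; rewrite inE eqxx.
have el : e \notin edges l.
  apply/negP => /sl; rewrite !inE edges_cat mem_cat edges_cat mem_cat.
  by rewrite ep.
have [h' h'l h'v] := ctrail_exit wl el; have /and5P[wp wq _ _ _] := opq.
have := isol h' _ h'l; rewrite h'v !inE !edges_cat !mem_cat !negb_or.
case: (boolP (h'.1 \in edges p)) => [h'p _|_].
  apply/orP; left; apply/hasP; exists (hend h') => //=.
  exact: half_edge_verts wp h'p.
case: (boolP (h'.1 \in edges q)) => [h'q _|_].
  apply/orP; right; apply/hasP; exists (hend h') => //=.
  exact: half_edge_verts wq h'q.
case: (boolP (h'.1 \in edges d)) => [h'd _|_ /(_ isT)//].
have [h1 h1l h1v] := verts_half_edge wl l0 h'v.
have : h1.1 \notin edges ((p ++ q) ++ d) by have := sl _ h1l; rewrite !inE.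
by move/(sat h' h1 h'd); rewrite h1v eqxx.
Qed.

Hypothesis Godd : odd (num_neg (full G)).

(** A trail covering all edges would have the parity of [G], which is odd. *)
Lemma even_uncovered s : uniq (edges s) -> ~~ parity s -> exists h, h.1 \notin edges s.
Proof.
move=> us ps.
have [e es|all_s] := pickP [pred e | e \notin edges s]; first by exists (e, true).
case/negP: ps; rewrite -(@odd_num_neg _ (full G)) // => e.
by rewrite in_setT; have /negbFE := all_s e.
Qed.

Hypothesis Geven : even_set [set: edge G].

(** Components of the uncovered edges are extracted one by one. An even one enlarges the pair at
    once; if a single odd one does not finish the cover, parity forces at least three. *)
Lemma odd_pair_triple_or_larger x p y q : odd_pair x p y q ->
  larger_odd_pair p q \/
  exists z l, [/\ walk z l z, uniq (edges (p ++ q ++ l)), parity l &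
    forall e, e \in edges (p ++ q ++ l)].
Proof.
move=> opq; have /and5P[wp wq u pp pq] := opq.
have ev0 : even_rest ((p ++ q) ++ [::]).
  move: u; rewrite cats0 edges_cat cat_uniq => /and3P[up dpq uq].
  apply: (even_rest_cat (z := y)); rewrite ?/ctrail ?wq //; last first.
    by rewrite edges_cat cat_uniq up dpq.
  rewrite -[p]cat0s; apply: (even_rest_cat (z := x)); rewrite ?/ctrail ?wp //.
  by rewrite /even_rest (_ : ~: _ = setT) //; apply/setP => e; rewrite !inE.
have sat0 : saturated (p ++ q) [::] by [].
have u0 : uniq (edges ((p ++ q) ++ [::])) by rewrite cats0.
have sub_uniq s s' : subseq s s' -> uniq (edges s') -> uniq (edges s).
  by move=> ss; apply: subseq_uniq; apply: map_subseq.
have [h1 h1d] : exists h, h.1 \notin edges ((p ++ q) ++ [::]).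
  by apply: even_uncovered; rewrite // cats0 parity_cat pp pq.
have [z1 [l1 [w1 u1 ev1 sat1 [l10 t1]]]] := next_component opq u0 ev0 sat0 h1d.
rewrite cat0s in u1 ev1 sat1.
have u1' : uniq (edges (p ++ q ++ l1)) by rewrite catA.
have [pl1|pl1] := boolP (parity l1); last by left; apply: join_even t1.
have [e2|none] := pickP [pred e | e \notin edges (p ++ q ++ l1)]; last first.
  by right; exists z1, l1; split=> // e; have /negbFE := none e.
rewrite /= catA => h2d.
have [z2 [l2 [w2 u2 ev2 sat2 [l20 t2]]]] :=
  next_component (h := (e2, true)) opq u1 ev1 sat1 h2d.
left.
have u2' : uniq (edges (p ++ q ++ l2)).
  apply: sub_uniq u2; rewrite -catA; apply/cat_subseq => //.
  by apply/cat_subseq => //; apply: suffix_subseq.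
have [pl2|pl2] := boolP (parity l2); last by apply: join_even t2.
(* Four odd trails have even total parity, so they cannot cover [G]. *)
have [h3 h3d] : exists h, h.1 \notin edges ((p ++ q) ++ l1 ++ l2).
  by apply: even_uncovered; rewrite // !parity_cat pp pq pl1 pl2.
have [z3 [l3 [w3 u3 ev3 sat3 [l30 t3]]]] := next_component opq u2 ev2 sat2 h3d.
have u12 : uniq (edges (p ++ q ++ l1 ++ l2)) by rewrite catA.
have u13 : uniq (edges (p ++ q ++ l1 ++ l3)).
  apply: sub_uniq u3; rewrite -!catA; do 3!apply/cat_subseq => //.
  exact: suffix_subseq.
have u23 : uniq (edges (p ++ q ++ l2 ++ l3)).
  apply: sub_uniq u3; rewrite -!catA; do 2!apply/cat_subseq => //.
  exact: suffix_subseq.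
have u3' : uniq (edges (p ++ q ++ l3)).
  apply: sub_uniq u23; do 2!apply/cat_subseq => //; exact: suffix_subseq.
have [pl3|pl3] := boolP (parity l3); last by apply: join_even t3.
have opq' : odd_pair y q x p by rewrite odd_pair_sym.
have swap l l' : uniq (edges (p ++ q ++ l ++ l')) -> uniq (edges (q ++ p ++ l ++ l')).
  rewrite (perm_uniq (perm_edges (_ : perm_eq _ (q ++ p ++ l ++ l')))) //.
  by rewrite perm_catCA.
(* Of three odd components, each touching [p] or [q], two touch the same trail. *)
case/orP: t1 => t1; case/orP: t2 => t2; case/orP: t3 => t3.
all: by [exact: join_two_odd opq w1 w2 u12 pl1 pl2 t1 t2
  |exact: join_two_odd opq w1 w3 u13 pl1 pl3 t1 t3
  |exact: join_two_odd opq w2 w3 u23 pl2 pl3 t2 t3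
  |apply/larger_odd_pairC; exact: join_two_odd opq' w1 w2 (swap _ _ u12) pl1 pl2 t1 t2
  |apply/larger_odd_pairC; exact: join_two_odd opq' w1 w3 (swap _ _ u13) pl1 pl3 t1 t3
  |apply/larger_odd_pairC; exact: join_two_odd opq' w2 w3 (swap _ _ u23) pl2 pl3 t2 t3].
Qed.

Definition odd_triple p q l : Prop := exists x y z,
  [/\ [/\ walk x p x, walk y q y & walk z l z], [/\ parity p, parity q & parity l],
     uniq (edges (p ++ q ++ l)) & forall e, e \in edges (p ++ q ++ l)].

Lemma odd_pair_triple x p y q : odd_pair x p y q -> exists p' q' l', odd_triple p' q' l'.
Proof.
have [n] := ubnP (#|edge G| - (size p + size q)).
elim: n x p y q => // n IHn x p y q lt_n opq.
have [|[z [l [wl u pl cov]]]] := odd_pair_triple_or_larger opq; last first.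
  by exists p, q, l, x, y, z; have /and5P[] := opq.
case=> x' [p' [y' [q' [opq' lt_pq]]]]; apply: (IHn _ _ _ _ _ opq').
rewrite -ltnS (leq_trans _ lt_n) // ltnS ltn_sub2l //.
apply: leq_trans lt_pq _; have /and5P[_ _ u _ _] := opq'.
rewrite -size_cat -cardsT; apply: size_edges_le u _ => e _; exact: in_setT.
Qed.

Definition even_cover r s : Prop := exists x y,
  [/\ ctrail x r, ctrail y s, ~~ parity r /\ ~~ parity s, r != [::] /\ s != [::] &
     forall e, (e \in edges r) || (e \in edges s)].

Lemma star_even_cover x p y q z l :
  [/\ walk x p x, walk y q y & walk z l z] ->
  [/\ parity p, parity q & parity l] -> uniq (edges (p ++ q ++ l)) ->
  (forall e, e \in edges (p ++ q ++ l)) -> touch x p y q -> touch x p z l ->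
  exists r s, even_cover r s.
Proof.
move=> [wp wq wl] [pp pq pl] u cov tq tl.
have [r [wr rE]] := walk_join wp wq tq; have [s [ws sE]] := walk_join wp wl tl.
exists r, s, x, x; split.
- rewrite /ctrail wr (perm_uniq (perm_edges rE)).
  by move: u; rewrite catA edges_cat cat_uniq => /andP[].
- rewrite /ctrail ws (perm_uniq (perm_edges sE)).
  by apply: subseq_uniq u; apply/map_subseq/cat_subseq => //; apply: suffix_subseq.
- by rewrite (parity_perm rE) (parity_perm sE) !parity_cat pp pq pl.
- by rewrite -!size_eq0 (perm_size rE) (perm_size sE) !size_eq0; case: (p) pp.
move=> e; have := cov e; rewrite (perm_mem (perm_edges rE)) (perm_mem (perm_edges sE)).
by rewrite !edges_cat !mem_cat => /or3P[] ->; rewrite ?orbT.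
Qed.

(** By connectedness each of the three trails touches another one; a graph on three vertices without
    isolated ones has a vertex adjacent to both others. *)
Lemma odd_triple_even_cover p q l : odd_triple p q l -> exists r s, even_cover r s.
Proof.
case=> x [y [z [[wp wq wl] [pp pq pl] u cov]]].
have touches x1 p1 x2 p2 x3 p3 : walk x1 p1 x1 -> walk x2 p2 x2 -> walk x3 p3 x3 ->
    parity p2 -> uniq (edges (p1 ++ p2 ++ p3)) ->
    (forall e, e \in edges (p1 ++ p2 ++ p3)) -> touch x1 p1 x2 p2 \/ touch x1 p1 x3 p3.
  move=> w1 w2 w3 pp2 u123 c123.
  have [e e2] : exists e, e \in edges p2.
    by case: (p2) pp2 => // h p2' _; exists h.1; rewrite inE eqxx.
  have e1 : e \notin edges p1.
    move: u123; rewrite edges_cat cat_uniq => /and3P[_ /hasPn d1 _]; apply: d1.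
    by rewrite edges_cat mem_cat e2.
  have [h h1 hv] := ctrail_exit w1 e1.
  have := c123 h.1; rewrite !edges_cat !mem_cat (negbTE h1) /= => /orP[h2|h3].
    by left; apply/hasP; exists (hend h); rewrite //; apply: half_edge_verts w2 h2.
  by right; apply/hasP; exists (hend h); rewrite //; apply: half_edge_verts w3 h3.
have Eqpl : perm_eq (p ++ q ++ l) (q ++ p ++ l) by rewrite perm_catCA.
have Elpq : perm_eq (p ++ q ++ l) (l ++ p ++ q) by rewrite [perm_eq _ _]perm_sym perm_catC -catA.
have uq : uniq (edges (q ++ p ++ l)) by rewrite -(perm_uniq (perm_edges Eqpl)).
have ul : uniq (edges (l ++ p ++ q)) by rewrite -(perm_uniq (perm_edges Elpq)).
have cq e : e \in edges (q ++ p ++ l) by rewrite -(perm_mem (perm_edges Eqpl)).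
have cl e : e \in edges (l ++ p ++ q) by rewrite -(perm_mem (perm_edges Elpq)).
have tp := touches _ _ _ _ _ _ wp wq wl pq u cov.
have tq := touches _ _ _ _ _ _ wq wp wl pp uq cq.
have tl := touches _ _ _ _ _ _ wl wp wq pp ul cl.
have at_p := @star_even_cover x p y q z l (And3 wp wq wl) (And3 pp pq pl) u cov.
have at_q := @star_even_cover y q x p z l (And3 wq wp wl) (And3 pq pp pl) uq cq.
have at_l := @star_even_cover z l x p y q (And3 wl wp wq) (And3 pl pp pq) ul cl.
move: tp tq tl at_p at_q at_l.
rewrite (touch_sym y q x) (touch_sym z l x) (touch_sym z l y).
by case=> t1 [] t2 [] t3 a1 a2 a3; auto.
Qed.

End Decomposition.

(** * Without two disjoint odd closed trails, deleting one edge balances the graph *)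

Section Balancing.

Lemma cat_eq_cat (T : Type) (s1 s2 t1 t2 : seq T) : s1 ++ s2 = t1 ++ t2 ->
  (exists r, t1 = s1 ++ r /\ s2 = r ++ t2) \/ (exists r, s1 = t1 ++ r /\ t2 = r ++ s2).
Proof.
elim: s1 t1 => [|c s1 IH] [|d t1] /=.
- by move=> ->; left; exists [::].
- by move=> ->; left; exists (d :: t1).
- by move=> <-; right; exists (c :: s1).
case=> <- /IH[[r [-> ->]]|[r [-> ->]]]; [by left; exists r|by right; exists r].
Qed.

(** [s1] is the longest prefix satisfying [Q], and [c] is the letter following it. *)
Lemma last_prefix (T : Type) (Q : seq T -> Prop) (s : seq T) : Q [::] -> ~ Q s ->
  exists s1 c s2, [/\ s = s1 ++ c :: s2, Q s1 &
    forall r r', s2 = r ++ r' -> ~ Q (s1 ++ c :: r)].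
Proof.
move=> Q0; elim/last_ind: s => // s c IH nQ.
have [Qs|nQs] := classic (Q s).
  exists s, c, [::]; rewrite cats1; split=> // -[|//] r' _.
  by rewrite cats1.
have [s1 [d [s2 [Ds Q1 nQ2]]]] := IH nQs.
exists s1, d, (rcons s2 c); rewrite {1}Ds rcons_cat; split=> // r r'.
elim/last_ind: r' => [|r' c' _]; first by rewrite cats0 => <-; rewrite -rcons_cons -rcons_cat -Ds.
by rewrite -rcons_cat => /rcons_inj[/nQ2].
Qed.

Lemma ex_minimal (T : Type) (P : T -> Prop) (f : T -> nat) :
  (exists x, P x) -> exists x, P x /\ forall y, P y -> f x <= f y.
Proof.
case=> x; have [n] := ubnP (f x); elim: n x => // n IHn x lt_x Px.
have [[y [Py lt_y]]|none] := classic (exists y, P y /\ f y < f x).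
  by apply: (IHn y) => //; lia.
by exists x; split=> // y Py; rewrite leqNgt; apply/negP => lt_y; apply: none; exists y.
Qed.

(** Reduces distinctness of edges, after cutting and regluing trails, to linear inequalities between
    counts. *)
Lemma uniq_count_le (T : eqType) (s s' : seq T) :
  (forall P, count P s' <= count P s) -> uniq s -> uniq s'.
Proof.
move=> le_s us; apply: count_mem_uniq => c; have := le_s (pred1 c).
rewrite (count_uniq_mem c us) => le1.
case: (boolP (c \in s')) => [|/count_memPn //].
by rewrite -has_pred1 has_count; lia.
Qed.

Context {G : sgraph}.
Implicit Types (x y z u v : vertex G) (h : half_edge G) (p q r s a b m : seq (half_edge G)).

Variables (t : seq (half_edge G)).
Hypothesis uniq_t : uniq (edges t).
Hypothesis all_t : forall e, e \in edges t.
Hypothesis odd_t : parity t.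
Hypothesis no_pair : forall x p y q, ~~ odd_pair x p y q.

(** Only the multiset of half-edges of [t] is kept, not their order, so that segments can be moved
    between [a] and [b]. *)
Definition odd_even_split u a b : Prop :=
  [/\ walk u a u, walk u b u, perm_eq (a ++ b) t & parity a].

Lemma no_disjoint_odd x p y q : walk x p x -> walk y q y -> parity p -> parity q ->
  (forall P, count P (edges (p ++ q)) <= count P (edges t)) -> False.
Proof.
move=> wp wq pp pq le_t; case/negP: (no_pair x p y q).
by rewrite /odd_pair wp wq pp pq (uniq_count_le le_t).
Qed.

Section Minimal.
Variables (u : vertex G) (a b : seq (half_edge G)).
Hypothesis ab : odd_even_split u a b.
Hypothesis min_a : forall u' a' b', odd_even_split u' a' b' -> size a <= size a'.

Let wa : walk u a u. Proof. by case: ab. Qed.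
Let wb : walk u b u. Proof. by case: ab. Qed.
Let pa : parity a. Proof. by case: ab. Qed.
Let eab : perm_eq (a ++ b) t. Proof. by case: ab. Qed.

Let pb : parity b = false.
Proof.
have := parity_perm eab; rewrite parity_cat odd_t pa.
by case: (parity b).
Qed.

Let count_ab P : count P (edges t) = count P (edges a) + count P (edges b).
Proof. by rewrite -(permP (perm_edges eab)) edges_cat count_cat. Qed.

(** The odd segment [m] could replace [a], the rest of [a] joining [b]; minimality leaves nothing
    outside [m]. *)
Lemma odd_segment f1 m f2 x : a = f1 ++ m ++ f2 ->
  walk u f1 x -> walk x m x -> parity m -> f1 ++ f2 = [::].
Proof.
move=> Da w1 wm pm; have w2 : walk x f2 u.
  by have := wa; rewrite Da (walk_cat _ _ w1) (walk_cat _ _ wm).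
have /min_a : odd_even_split x m (f2 ++ b ++ f1).
  split=> //; first by rewrite (walk_cat _ _ w2) (walk_cat _ _ wb).
  apply: perm_trans eab; rewrite Da; apply/permP => P; rewrite !count_cat; clear; lia.
rewrite Da !size_cat => le_a; apply/nilP; rewrite /nilp size_cat; lia.
Qed.

(** A nonempty even closed segment of [a] that meets [b] at [y] could be moved into [b] there,
    making [a] shorter but still odd. *)
Lemma even_segment f1 m1 m2 f2 x y b1 b2 : a = f1 ++ (m1 ++ m2) ++ f2 ->
  walk u f1 x -> walk x m1 y -> walk y m2 x -> ~~ parity (m1 ++ m2) ->
  m1 ++ m2 != [::] -> b = b1 ++ b2 -> walk u b1 y -> False.
Proof.
move=> Da w1 wm1 wm2 pm m0 Db wb1.
have wm : walk x (m1 ++ m2) x by rewrite (walk_cat _ _ wm1).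
have w2 : walk x f2 u.
  by have := wa; rewrite Da (walk_cat _ _ w1) (walk_cat _ _ wm).
have wb2 : walk y b2 u by have := wb; rewrite Db (walk_cat _ _ wb1).
have /min_a : odd_even_split u (f1 ++ f2) (b1 ++ m2 ++ m1 ++ b2).
  split; first by rewrite (walk_cat _ _ w1).
  - by rewrite (walk_cat _ _ wb1) (walk_cat _ _ wm2) (walk_cat _ _ wm1).
  - apply: perm_trans eab; rewrite Da Db; apply/permP => P; rewrite !count_cat; clear; lia.
  - by have := pa; rewrite Da !(parity_cat f1) parity_cat (negbTE pm).
rewrite Da !size_cat leq_add2l -[X in _ <= X]add0n leq_add2r leqn0 -size_cat.
by rewrite size_eq0 (negbTE m0).
Qed.

(** An odd [m] would form an odd pair with [a]. *)
Lemma complement_segment b1 m b2 x : b = b1 ++ m ++ b2 ->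
  walk u b1 x -> walk x m x -> parity m = false.
Proof.
move=> Db w1 wm; apply/negP => pm; apply: (no_disjoint_odd wm wa pm pa) => P.
by rewrite count_ab Db !edges_cat !count_cat; clear; lia.
Qed.

(* Otherwise [a1] and [a3], closed up along disjoint parts of [b], would give two
   edge-disjoint odd closed trails. *)
Lemma monotone_offset a1 a2 a3 b1 b2 c1 c2 x y :
  a = a1 ++ a2 ++ a3 -> walk u a1 x -> walk x a2 y ->
  b = b1 ++ b2 -> walk u b1 x -> b = c1 ++ c2 -> walk u c1 y ->
  parity (a1 ++ a2) = parity c1 -> parity a1 = parity b1.
Proof.
move=> Da w1 w2 Db wb1 Dc wc1 p12; apply/eqP; rewrite -negb_add; apply/negP => p1.
have w3 : walk y a3 u by have := wa; rewrite Da (walk_cat _ _ w1) (walk_cat _ _ w2).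
have wb2 : walk x b2 u by have := wb; rewrite Db (walk_cat _ _ wb1).
have wc2 : walk y c2 u by have := wb; rewrite Dc (walk_cat _ _ wc1).
have pb2 : parity b2 = parity b1.
  by have := pb; rewrite Db parity_cat; case: (parity b1); case: (parity b2).
have pc2 : parity c2 = parity c1.
  by have := pb; rewrite Dc parity_cat; case: (parity c1); case: (parity c2).
have p3 : parity (a3 ++ c1).
  by have := pa; rewrite Da catA (parity_cat (a1 ++ a2)) (parity_cat a3) p12 addbC.
(* If [x] precedes [y] on [b], close up along [b1] and [c2] backwards; if [y] comes first, along
   [b2] and [c1] forwards. In both cases the two pieces of [b] are disjoint. *)
have := Db; rewrite Dc => /esym/cat_eq_cat[[c [Dc1 Db2]]|[c [Db1 Dc2]]].
  have wr1 : walk u (a1 ++ rev (map flip b1)) u by rewrite (walk_cat _ _ w1) walk_rev.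
  have wr3 : walk y (a3 ++ rev (map flip c2)) y by rewrite (walk_cat _ _ w3) walk_rev.
  apply: (no_disjoint_odd wr1 wr3) => [||P].
  - by rewrite parity_cat parity_rev.
  - by rewrite parity_cat parity_rev pc2 -parity_cat.
  by rewrite count_ab Da Dc Dc1 !(edges_cat, edges_rev, count_cat, count_rev); clear; lia.
have wr1 : walk u (a1 ++ b2) u by rewrite (walk_cat _ _ w1).
have wr3 : walk y (a3 ++ c1) y by rewrite (walk_cat _ _ w3).
apply: (no_disjoint_odd wr1 wr3) => [||P] //.
  by rewrite parity_cat pb2.
by rewrite count_ab Da Db Db1 !(edges_cat, count_cat); clear; lia.
Qed.

(** The segment of [a] between the two ends is closed, and if odd it is all of [a]. The two
    inequations exclude exactly this: one prefix empty and the other equal to [a]. *)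
Lemma prefix_parity f f' g g' x : a = f ++ g -> a = f' ++ g' ->
  walk u f x -> walk u f' x -> f ++ g' != [::] -> f' ++ g != [::] ->
  parity f = parity f'.
Proof.
wlog [m Df] : f f' g g' / exists m, f' = f ++ m.
  move=> W Da Da'; have := Da; rewrite Da' => /esym/cat_eq_cat[[m [Dm _]]|[m [Dm _]]].
    by apply: (W _ _ _ _ _ Da Da'); exists m.
  by move=> w w' n n'; apply/esym; apply: (W _ _ _ _ _ Da' Da) => //; exists m.
rewrite {f'}Df => _ Da w; rewrite (walk_cat _ _ w) => wm n _.
rewrite parity_cat; have [pm|_] := boolP (parity m); last by rewrite addbF.
by case/negP: n; apply/eqP/(odd_segment (m := m) _ w wm pm); rewrite Da catA.
Qed.

Lemma balancing_edge_minimal : exists (e : edge G) (pot : vertex G -> bool),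
  forall f, neg f = pot (hend (f, true)) (+) pot (hend (f, false)) (+) (f == e).
Proof.
(* [Q] selects the prefixes of [a] ending at a vertex of [b] with equal parities along [a] and [b].
   The empty prefix qualifies; [a] itself does not, because closed segments of [b] are even. *)
pose Q a1 := exists x b1 b2,
  [/\ b = b1 ++ b2, walk u a1 x, walk u b1 x & parity a1 = parity b1].
have Q0 : Q [::] by exists u, [::], b; rewrite /= eqxx.
have nQa : ~ Q a.
  case=> x [b1 [b2 [Db wax wb1]]]; rewrite pa.
  have ux := walk_inj wa wax; subst x.
  by rewrite (@complement_segment [::] b1 b2 u Db (eqxx u) wb1).
have [a1 [h [a2 [Da Q1 last1]]]] := last_prefix Q0 nQa.
have [x1 [d1 [d2 [Dd wa1 wd1 pd1]]]] := Q1.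
have [Eh w2] : hend h = x1 /\ walk (hend (flip h)) a2 u.
  by have := wa; rewrite Da (walk_cat _ _ wa1) /= => /andP[/eqP].
have wa1h r x : walk u (a1 ++ h :: r) x = walk (hend (flip h)) r x.
  by rewrite (walk_cat _ _ wa1) /= Eh eqxx.
have pa12 : parity a2 = ~~ (parity a1 (+) neg h.1).
  have := pa; rewrite Da parity_cat parity_cons.
  by move: (parity a1) (parity a2) (neg h.1) => [] [] [].
(* [w] is the closed Euler trail with [h] removed, starting at the far end [o] of [h]. The aim is
   that the parity of a prefix of [w] depends only on its end. *)
pose w := a2 ++ b ++ a1; set o := hend (flip h) in w2 wa1h.
(* The digits in [c11], [c12] and so on tell in which of the pieces [a2], [b], [a1] of [w] the two
   compared prefixes end. *)
have c11 r s r' s' x : a2 = r ++ s -> a2 = r' ++ s' -> walk o r x -> walk o r' x ->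
    parity r = parity r'.
  move=> D D' wr wr'; apply: (@addbI (parity (a1 ++ [:: h]))).
  rewrite -!parity_cat -!catA; apply: (prefix_parity (x := x) (g := s) (g' := s')).
  - by rewrite Da D -!catA.
  - by rewrite Da D' -!catA.
  - by rewrite wa1h.
  - by rewrite wa1h.
  - by case: (a1).
  - by case: (a1).
have c33 f g f' g' x : a1 = f ++ g -> a1 = f' ++ g' -> walk u f x -> walk u f' x ->
    parity f = parity f'.
  move=> D D' wf wf'.
  apply: (prefix_parity (g := g ++ h :: a2) (g' := g' ++ h :: a2) _ _ wf wf').
  - by rewrite Da D -!catA.
  - by rewrite Da D' -!catA.
  - by case: (f) => //; case: (g').
  - by case: (f') => //; case: (g).
have c22 f g f' g' x : b = f ++ g -> b = f' ++ g' -> walk u f x -> walk u f' x ->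
    parity f = parity f'.
  wlog [m Df] : f f' g g' / exists m, f' = f ++ m.
    move=> W D D'; have := D; rewrite D' => /esym/cat_eq_cat[[m [Dm _]]|[m [Dm _]]].
      by apply: (W _ _ _ _ _ D D'); exists m.
    by move=> wf wf'; apply/esym; apply: (W _ _ _ _ _ D' D) => //; exists m.
  rewrite {f'}Df => _ D wf; rewrite (walk_cat _ _ wf) parity_cat => wm.
  by rewrite -catA in D; rewrite (complement_segment D wf wm) addbF.
have c12 r s b1 b2 x : a2 = r ++ s -> b = b1 ++ b2 -> walk o r x -> walk u b1 x ->
    parity r = parity (a2 ++ b1).
  move=> D Db wr wb1; have /eqP : parity (a1 ++ h :: r) <> parity b1.
    by move=> E; apply: (last1 r s D); exists x, b1, b2; rewrite wa1h.
  rewrite !parity_cat parity_cons pa12.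
  by move: (parity a1) (parity b1) (parity r) (neg h.1) => [] [] [] [].
have c23 b1 b2 f g x : b = b1 ++ b2 -> a1 = f ++ g -> walk u b1 x -> walk u f x ->
    parity (a2 ++ b1) = parity (a2 ++ b ++ f).
  move=> Db D wb1 wf; rewrite !parity_cat pb; congr (_ (+) _).
  have wg : walk x g x1 by move: wa1; rewrite D (walk_cat _ _ wf).
  (* The agreement at [x1], where [a1] ends, is carried back to the earlier visit at [x]. *)
  symmetry; apply: (monotone_offset (a2 := g) (a3 := h :: a2) _ wf wg Db wb1 Dd wd1).
    by rewrite Da D -catA.
  by rewrite -D pd1.
have c13 r s f g x : a2 = r ++ s -> a1 = f ++ g -> walk o r x -> walk u f x ->
    parity r = parity (a2 ++ b ++ f).
  move=> D D' wr wf; rewrite !parity_cat pb pa12.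
  have wg : walk x g x1 by move: wa1; rewrite D' (walk_cat _ _ wf).
  apply/eqP/negPn/negP => ne.
  (* Unequal parities would make the closed segment [g ++ h :: r] of [a] even; it passes through
     [x1], a vertex of [b]. *)
  apply: (even_segment (f1 := f) (m1 := g) (m2 := h :: r) (f2 := s) _ wf wg _ _ _ Dd wd1).
  - by rewrite Da D' D -!catA.
  - by rewrite /= Eh eqxx.
  - move: ne; rewrite D' !parity_cat parity_cons.
    by move: (parity f) (parity g) (parity r) (neg h.1) => [] [] [] [].
  - by case: (g).
have consistent r s r' s' x : w = r ++ s -> w = r' ++ s' -> walk o r x -> walk o r' x ->
    parity r = parity r'.
  have kinds r0 s0 : w = r0 ++ s0 -> walk o r0 x ->
      [\/ exists c, a2 = r0 ++ c,
          exists b1 b2, [/\ b = b1 ++ b2, r0 = a2 ++ b1 & walk u b1 x] |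
          exists f g, [/\ a1 = f ++ g, r0 = a2 ++ b ++ f & walk u f x]].
    move=> /esym/cat_eq_cat[[c [-> _]]|]; first by constructor 1; exists c.
    case=> c [-> /cat_eq_cat[[c' [-> Da1]]|[c' [Db _]]]]; rewrite (walk_cat _ _ w2).
      by rewrite (walk_cat _ _ wb); constructor 3; exists c', s0.
    by constructor 2; exists c, c'.
  move=> D D' wr wr'.
  case: (kinds _ _ D wr) => [[c Dr]|[b1 [b2 [Dr -> wr1]]]|[f [g [Dr -> wr1]]]];
  case: (kinds _ _ D' wr') => [[c' Dr']|[b1' [b2' [Dr' -> wr1']]]|[f' [g' [Dr' -> wr1']]]].
  - exact: c11 Dr Dr' wr wr'.
  - exact: c12 Dr Dr' wr wr1'.
  - exact: c13 Dr Dr' wr wr1'.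
  - by apply/esym; exact: c12 Dr' Dr wr' wr1.
  - by rewrite !parity_cat (c22 _ _ _ _ _ Dr Dr' wr1 wr1').
  - exact: c23 Dr Dr' wr1 wr1'.
  - by apply/esym; exact: c13 Dr' Dr wr' wr1.
  - by apply/esym; exact: c23 Dr' Dr wr1' wr1.
  - by rewrite !parity_cat (c33 _ _ _ _ _ Dr Dr' wr1 wr1').
(* By [consistent], this is the parity of any prefix of [w] ending at [x]. *)
pose pot x := [exists i : 'I_(size w).+1, walk o (take i w) x && parity (take i w)].
have potE r s x : w = r ++ s -> walk o r x -> pot x = parity r.
  move=> D wr; apply/existsP/idP => [[i /andP[wi pi]]|pr].
    by rewrite (consistent _ _ _ _ _ D (esym (cat_take_drop i w)) wr wi).
  have ir : size r < (size w).+1 by rewrite ltnS D size_cat leq_addr.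
  by exists (Ordinal ir); rewrite /= D take_size_cat // wr.
have ww : walk o w x1 by rewrite (walk_cat _ _ w2) (walk_cat _ _ wb).
have perm_w : perm_eq (h :: w) t.
  apply: perm_trans eab; rewrite Da /w; apply/permP => P.
  by rewrite /= !count_cat /=; clear; lia.
have pot_half d : pot (hend (d.1, true)) (+) pot (hend (d.1, false)) =
    pot (hend d) (+) pot (hend (flip d)).
  by case: d => e [] //=; rewrite addbC.
exists h.1, pot => f; have [->|nfh] := eqVneq f h.1.
  (* The ends of [h] have potentials 0 and [parity w], and [h :: w] is odd; hence the defect at [h]
     alone. *)
  rewrite pot_half -/o (potE [::] w o) //= ?eqxx // Eh (potE w [::] x1) ?cats0 //.
  have := parity_perm perm_w; rewrite odd_t parity_cons.
  by case: (neg _); case: (parity w).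
have : f \in edges w.
  have := all_t f; rewrite -(perm_mem (perm_edges perm_w)) inE (negbTE nfh).
  by [].
case/mapP=> d /splitPr Dw -> {nfh}; case: Dw ww potE => r s ww potE.
have [y wr /= /andP[/eqP dy _]] := walk_split ww.
rewrite pot_half (potE r (d :: s)) // ?dy //.
rewrite (potE (rcons r d) s) ?cat_rcons //; last first.
  by rewrite -cats1 (walk_cat _ _ wr) /= dy !eqxx.
by rewrite -cats1 parity_cat parity_cons addbF addbF addKb.
Qed.

End Minimal.

Lemma balancing_edge x : walk x t x -> exists (e : edge G) (pot : vertex G -> bool),
  forall f, neg f = pot (hend (f, true)) (+) pot (hend (f, false)) (+) (f == e).
Proof.
move=> wt; pose P abu := odd_even_split abu.1.1 abu.1.2 abu.2.
have [|[[u a] b] /= [ab min_ab]] := @ex_minimal _ P (fun abu => size abu.1.2).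
  by exists (x, t, [::]); split; rewrite /= ?eqxx // cats0.
apply: (balancing_edge_minimal ab) => u' a' b' ab'.
exact: (min_ab (u', a', b') ab').
Qed.

End Balancing.

(** * Flows: the obstruction from a balancing edge, and flows carried by trails *)

Section Flows.
Import GRing.Theory Num.Theory.
Local Open Scope ring_scope.
Context {G : sgraph}.
Implicit Types (x y v : vertex G) (h : half_edge G) (p q : seq (half_edge G)).
Implicit Types (o : half_edge G -> bool) (xi : edge G -> int).

Definition outflow o xi v : int := \sum_(h | hend h == v) (-1) ^+ o h * xi h.1.

Lemma is_flowE o xi : is_flow o xi <-> forall v, outflow o xi v = 0.
Proof.
suff E v : \sum_(h in half_edges_at (full G) v | ~~ o h) xi h.1
    - \sum_(h in half_edges_at (full G) v | o h) xi h.1 = outflow o xi v.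
  by split=> H v; have := H v; rewrite E.
rewrite /outflow [RHS](bigID o) /= [RHS]addrC -sumrN; congr (_ + _).
  apply: eq_big => [h|h /andP[_ /negbTE->]]; last by rewrite mul1r.
  by rewrite !inE.
apply: eq_big => [h|h /andP[_ ->]]; last by rewrite mulN1r.
by rewrite !inE.
Qed.

Lemma sum_half_edges (F : half_edge G -> int) :
  \sum_h F h = \sum_e (F (e, true) + F (e, false)).
Proof.
rewrite (eq_bigr (fun h => F (h.1, h.2))) => [|[e b] _ //].
rewrite -(pair_bigA _ (fun e b => F (e, b))) /=.
by apply: eq_bigr => e _; rewrite big_bool.
Qed.

Lemma orientationE o e : orientation o -> o (e, false) = o (e, true) (+) ~~ neg e.
Proof.
move=> /(_ e); case: (neg e) => [->|]; first by rewrite addbF.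
by case: (o (e, true)); case: (o (e, false)).
Qed.

(* Weighting the conservation law at [v] by [(-1) ^+ pot v] and summing over all
   vertices, every edge but [e] cancels. *)
Lemma balancing_edge_flow o xi e (pot : vertex G -> bool) :
  orientation o -> is_flow o xi ->
  (forall f, neg f = pot (hend (f, true)) (+) pot (hend (f, false)) (+) (f == e)) ->
  xi e = 0.
Proof.
move=> oo /is_flowE flow negE.
have: \sum_v (-1) ^+ pot v * outflow o xi v = 0.
  by apply: big1 => v _; rewrite flow mulr0.
under eq_bigr do rewrite /outflow big_distrr big_mkcond /=.
rewrite exchange_big /=.
rewrite (eq_bigr (fun h => (-1) ^+ pot (hend h) * ((-1) ^+ o h * xi h.1))); last first.
  move=> h _; rewrite (bigD1 (hend h)) //= eqxx big1 ?addr0 // => v.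
  by rewrite eq_sym => /negbTE->.
(* The two halves of an edge carry opposite weighted signs except at [e], where they agree and leave
   [2 * xi e] up to sign. *)
rewrite sum_half_edges (bigD1 e) //= big1 => [|f /negbTE fe].
  rewrite addr0 (orientationE e oo) (negE e) eqxx.
  by case: (pot _); case: (pot _); case: (o _); rewrite /= ?expr0 ?expr1; lia.
rewrite (orientationE f oo) (negE f) fe.
by case: (pot _); case: (pot _); case: (o _); rewrite /= ?expr0 ?expr1; lia.
Qed.

(* [c] is the parity of the part of the trail that has already been traversed. *)
Fixpoint trail_flow o (c : bool) p (e : edge G) : int :=
  if p is h :: q then
    (e == h.1)%:R * (-1) ^+ (c (+) o h) + trail_flow o (c (+) neg h.1) q e
  else 0.

Lemma outflowD o xi xi' v k :
  outflow o (fun e => xi e + k * xi' e) v = outflow o xi v + k * outflow o xi' v.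
Proof.
rewrite /outflow big_distrr -big_split; apply: eq_bigr => h _ /=.
by rewrite mulrDr mulrCA.
Qed.

Lemma outflow_edge o h c v : orientation o ->
  outflow o (fun e => (e == h.1)%:R * (-1) ^+ (c (+) o h)) v =
  (-1) ^+ c * (hend h == v)%:R - (-1) ^+ (c (+) neg h.1) * (hend (flip h) == v)%:R.
Proof.
move=> oo; rewrite /outflow big_mkcond sum_half_edges (bigD1 h.1) //= big1; last first.
  by move=> f /negbTE->; rewrite !mul0r !mulr0 !if_same.
case: h => e [] /=; rewrite eqxx addr0 (orientationE e oo) /flip /=.
all: move: (o (e, true)) c (neg e) => [] [] []; do 2!case: eqP => _.
all: by rewrite /= ?expr0 ?expr1; lia.
Qed.

(** Contributions at inner vertices telescope. On a closed trail the two remaining terms cancel if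
    the parity is even. *)
Lemma outflow_trail o c x p y v : orientation o -> walk x p y ->
  outflow o (trail_flow o c p) v =
  (-1) ^+ c * (x == v)%:R - (-1) ^+ (c (+) parity p) * (y == v)%:R.
Proof.
move=> oo; elim: p c x => [|h p IHp] c x /= => [/eqP->|/andP[/eqP<- wp]].
  by rewrite addbF subrr /outflow big1 // => h _; rewrite mulr0.
rewrite -[outflow _ _ _]/(outflow o (fun e => _ + trail_flow o (c (+) neg h.1) p e) v).
transitivity (outflow o (fun e => (e == h.1)%:R * (-1) ^+ (c (+) o h)
    + 1 * trail_flow o (c (+) neg h.1) p e) v).
  by apply: eq_bigr => h' _; rewrite mul1r.
rewrite outflowD mul1r outflow_edge // (IHp _ _ wp) parity_cons addbA.
by rewrite addrA subrK.
Qed.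

Lemma trail_flow_notin o c p e : e \notin edges p -> trail_flow o c p e = 0.
Proof.
elim: p c => //= h p IHp c; rewrite inE negb_or => /andP[/negbTE-> /IHp->].
by rewrite mul0r addr0.
Qed.

Lemma trail_flow_in o c p e : uniq (edges p) -> e \in edges p ->
  trail_flow o c p e = 1 \/ trail_flow o c p e = -1.
Proof.
elim: p c => //= h p IHp c /andP[hp up]; rewrite inE.
have [-> _|_ /=] := eqVneq e h.1.
  by rewrite trail_flow_notin // addr0 mul1r; case: (_ (+) _); [right|left].
by rewrite mul0r add0r; apply: IHp.
Qed.

Definition standard_orientation h : bool := neg h.1 || h.2.

Lemma standard_orientationP : orientation standard_orientation.
Proof. by move=> e; rewrite /standard_orientation /=; case: (neg e). Qed.

Lemma even_ctrail_flow o x p v : orientation o -> ctrail x p -> ~~ parity p ->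
  outflow o (trail_flow o false p) v = 0.
Proof.
by move=> oo /andP[wp _] /negbTE pp; rewrite (outflow_trail _ _ oo wp) pp subrr.
Qed.

Lemma even_cover_kflow x p y q : ctrail x p -> ctrail y q ->
  ~~ parity p -> ~~ parity q -> (forall e, (e \in edges p) || (e \in edges q)) ->
  has_nowhere_zero_kflow G 4.
Proof.
move=> cp cq pp pq cov; pose o := standard_orientation.
have oo : orientation o := standard_orientationP.
(* The values are 1 or -1 on edges of [p] only, 2 or -2 on edges of [q] only, and odd of absolute
   value 1 or 3 on common edges. *)
exists o, (fun e => trail_flow o false p e + 2 * trail_flow o false q e); split=> //.
  apply/is_flowE => v; rewrite outflowD (even_ctrail_flow _ oo cp) //.
  by rewrite (even_ctrail_flow _ oo cq).
move=> e; have /andP[_ up] := cp; have /andP[_ uq] := cq; have := cov e.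
have [ep _|ep /= eq] := boolP (e \in edges p).
  have [eq|eq] := boolP (e \in edges q); last first.
    by rewrite (trail_flow_notin _ _ eq); case: (trail_flow_in o false up ep) => ->.
  by case: (trail_flow_in o false up ep) => ->; case: (trail_flow_in o false uq eq) => ->.
by rewrite (trail_flow_notin _ _ ep); case: (trail_flow_in o false uq eq) => ->.
Qed.

End Flows.

(** * Translating trails into the conditions on subgraphs, and the equivalence *)

Section Equivalences.
Context {G : sgraph}.
Hypotheses (Geul : eulerian (full G)) (Godd : odd (num_neg (full G))).

Lemma even_full : even_set [set: edge G].
Proof. by move=> v; have [_ ev] := Geul; apply: ev; rewrite inE. Qed.

Lemma odd_pair_eulerian (H1 H2 : subgraph G) :
  eulerian H1 -> eulerian H2 -> odd (num_neg H1) -> odd (num_neg H2) ->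
  edge_disjoint H1 H2 -> exists x p y q, @odd_pair G x p y q.
Proof.
move=> /euler_ctrail[x [p [/andP[wp up] _ pH]]] /euler_ctrail[y [q [/andP[wq uq] _ qH]]].
rewrite (odd_num_neg up pH) (odd_num_neg uq qH) => pp pq dis.
exists x, p, y, q; rewrite /odd_pair wp wq pp pq edges_cat cat_uniq up uq !andbT /=.
apply/hasPn => e; rewrite /= qH pH => e2; apply/negP => e1.
by have := disjointFr dis e1; rewrite e2.
Qed.

Lemma flow_odd_pair : has_nowhere_zero_flow G -> exists x p y q, @odd_pair G x p y q.
Proof.
case=> o [xi [oo flow nz]].
have [//|none] := classic (exists x p y q, @odd_pair G x p y q).
have [x [t [/andP[wt ut] _ tE]]] := euler_ctrail Geul.
have [|||e [pot negE]] := @balancing_edge G t ut _ _ _ x wt.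
- by move=> e; rewrite tE inE.
- by rewrite -(odd_num_neg ut tE).
- by move=> y p z q; apply/negP => op; apply: none; exists y, p, z, q.
by have := nz e; rewrite (balancing_edge_flow oo flow negE) eqxx.
Qed.

Lemma odd_pair_circuits : (exists x p y q, @odd_pair G x p y q) ->
  exists C1 C2 : subgraph G,
    [/\ unbalanced_circuit C1, unbalanced_circuit C2 & edge_disjoint C1 C2].
Proof.
case=> x [p [y [q /and5P[wp wq u pp pq]]]].
move: u; rewrite edges_cat cat_uniq => /and3P[up dpq uq].
have [|C1 [u1 s1]] := @odd_ctrail_circuit G x p _ pp; first by rewrite /ctrail wp.
have [|C2 [u2 s2]] := @odd_ctrail_circuit G y q _ pq; first by rewrite /ctrail wq.
exists C1, C2; split=> //; rewrite /edge_disjoint disjoint_subset.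
apply/subsetP => e /s1 e1; rewrite inE; apply: contra dpq => /s2 e2.
by apply/hasP; exists e.
Qed.

Lemma circuits_odd_pair :
  (exists C1 C2 : subgraph G,
    [/\ unbalanced_circuit C1, unbalanced_circuit C2 & edge_disjoint C1 C2]) ->
  exists x p y q, @odd_pair G x p y q.
Proof.
have circ_eul C : @circuit G C -> eulerian C.
  by case=> cC vC; split=> // v /vC ->.
case=> C1 [C2 [[c1 o1] [c2 o2] dis]].
exact: odd_pair_eulerian (circ_eul _ c1) (circ_eul _ c2) o1 o2 dis.
Qed.

(** As [G] has a negative edge, its Euler trail is nonempty, and it visits every vertex. Thus
    subgraphs covering all edges also cover all vertices. *)
Lemma vertex_half_edge (v : vertex G) : exists h : half_edge G, hend h = v.
Proof.
have [x [t [/andP[wt ut] _ tE]]] := euler_ctrail Geul.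
have t0 : t != [::].
  by apply: parity_nonempty; rewrite -(odd_num_neg ut tE).
have [|h _ hv] := verts_half_edge wt t0 (v := v); last by exists h.
apply: (@isolated_walk_verts G (full G)); rewrite ?inE //; first by case: Geul.
by move=> h _; rewrite tE inE.
Qed.

Lemma odd_pair_even_cover : (exists x p y q, @odd_pair G x p y q) ->
  exists H1 H2 : subgraph G,
    [/\ eulerian H1 /\ ~~ odd (num_neg H1), eulerian H2 /\ ~~ odd (num_neg H2),
        vset H1 :|: vset H2 = [set: vertex G] & eset H1 :|: eset H2 = [set: edge G]].
Proof.
have [conn _] := Geul.
case=> x [p [y [q op]]].
have [p' [q' [l' tr]]] := odd_pair_triple conn Godd even_full op.
have [r [s [x' [y' [cr cs [pr ps] [r0 s0] cov]]]]] := odd_triple_even_cover conn tr.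
exists (edge_subgraph [set e in edges r]), (edge_subgraph [set e in edges s]); split.
- split; first exact: eulerian_ctrail cr r0.
  by have /andP[_ ur] := cr; rewrite (odd_num_neg ur) // => e; rewrite inE.
- split; first exact: eulerian_ctrail cs s0.
  by have /andP[_ us] := cs; rewrite (odd_num_neg us) // => e; rewrite inE.
- apply/setP => v; have [h <-] := vertex_half_edge v; rewrite !inE.
  have /orP[hr|hs] := cov h.1; apply/orP; [left|right].
    by apply/existsP; exists h; rewrite inE hr eqxx.
  by apply/existsP; exists h; rewrite inE hs eqxx.
by apply/setP => e; rewrite !inE cov.
Qed.

Lemma odd_pair_decomposition : (exists x p y q, @odd_pair G x p y q) ->
  exists H1 H2 H3 : subgraph G,
    [/\ [/\ eulerian H1, eulerian H2 & eulerian H3],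
        [/\ odd (num_neg H1), odd (num_neg H2) & odd (num_neg H3)],
        [/\ edge_disjoint H1 H2, edge_disjoint H1 H3 & edge_disjoint H2 H3],
        vset H1 :|: vset H2 :|: vset H3 = [set: vertex G] &
        eset H1 :|: eset H2 :|: eset H3 = [set: edge G]].
Proof.
have [conn _] := Geul.
case=> x0 [p0 [y0 [q0 op]]].
have [p [q [l [x [y [z [[wp wq wl] [pp pq pl] u cov]]]]]]] :=
  odd_pair_triple conn Godd even_full op.
pose S s := edge_subgraph [set e in @edges G s].
have dis s s' : uniq (edges (s ++ s')) -> edge_disjoint (S s) (S s').
  rewrite edges_cat cat_uniq => /and3P[_ /hasPn d _].
  rewrite /edge_disjoint disjoint_sym disjoint_subset; apply/subsetP => e.
  by rewrite !inE => /d.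
have upq : uniq (edges (p ++ q)).
  by move: u; rewrite catA edges_cat cat_uniq => /and3P[].
have uql : uniq (edges (q ++ l)).
  by move: u; rewrite edges_cat cat_uniq => /and3P[].
have upl : uniq (edges (p ++ l)).
  by apply: subseq_uniq u; apply/map_subseq/cat_subseq => //; apply: suffix_subseq.
have [up uq] : uniq (edges p) /\ uniq (edges q).
  by move: upq; rewrite edges_cat cat_uniq => /and3P[].
have ul : uniq (edges l) by move: uql; rewrite edges_cat cat_uniq => /and3P[].
have oddS s : uniq (edges s) -> parity s -> odd (num_neg (S s)).
  by move=> us ps; rewrite (odd_num_neg us) // => e; rewrite inE.
have eulS w s : walk w s w -> uniq (edges s) -> parity s -> eulerian (S s).
  move=> ws us ps; apply: (@eulerian_ctrail _ w); first by rewrite /ctrail ws.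
  exact: parity_nonempty.
exists (S p), (S q), (S l); split.
- by split; [apply: eulS wp _ _|apply: eulS wq _ _|apply: eulS wl _ _].
- by split; apply: oddS.
- by split; apply: dis.
- apply/setP => v; have [h <-] := vertex_half_edge v; rewrite !inE -orbA.
  have := cov h.1; rewrite !edges_cat !mem_cat => /or3P[] he; apply/or3P.
  + by constructor 1; apply/existsP; exists h; rewrite inE he eqxx.
  + by constructor 2; apply/existsP; exists h; rewrite inE he eqxx.
  + by constructor 3; apply/existsP; exists h; rewrite inE he eqxx.
by apply/setP => e; have := cov e; rewrite !inE !edges_cat !mem_cat orbA.
Qed.

Lemma even_subgraphs_kflow :
  (exists H1 H2 : subgraph G,
    [/\ eulerian H1 /\ ~~ odd (num_neg H1), eulerian H2 /\ ~~ odd (num_neg H2),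
        vset H1 :|: vset H2 = [set: vertex G] &
        eset H1 :|: eset H2 = [set: edge G]]) ->
  has_nowhere_zero_kflow G 4.
Proof.
case=> H1 [H2 [[/euler_ctrail[x [p [cp _ pE]]] p1] [/euler_ctrail[y [q [cq _ qE]]] q1]]].
move=> _ cov; have [/andP[_ up] /andP[_ uq]] := conj cp cq.
rewrite (odd_num_neg up pE) in p1; rewrite (odd_num_neg uq qE) in q1.
apply: (even_cover_kflow cp cq p1 q1) => e.
by rewrite pE qE -in_setU cov inE.
Qed.

End Equivalences.

Theorem theorem9 (G : sgraph) (G_eulerian : eulerian (full G))
    (G_odd : odd (num_neg (full G))) :
  [<-> (* (a) *) has_nowhere_zero_flow G;
       (* (b) *) has_nowhere_zero_kflow G 4;
       (* (c) *) exists C1 C2 : subgraph G,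
         [/\ unbalanced_circuit C1, unbalanced_circuit C2 & edge_disjoint C1 C2];
       (* (d) *) exists H1 H2 : subgraph G,
         [/\ eulerian H1 /\ ~~ odd (num_neg H1),
             eulerian H2 /\ ~~ odd (num_neg H2),
             vset H1 :|: vset H2 = [set: vertex G] &
             eset H1 :|: eset H2 = [set: edge G]];
       (* (e) *) exists H1 H2 H3 : subgraph G,
         [/\ [/\ eulerian H1, eulerian H2 & eulerian H3],
             [/\ odd (num_neg H1), odd (num_neg H2) & odd (num_neg H3)],
             [/\ edge_disjoint H1 H2, edge_disjoint H1 H3 & edge_disjoint H2 H3],
             vset H1 :|: vset H2 :|: vset H3 = [set: vertex G] &
             eset H1 :|: eset H2 :|: eset H3 = [set: edge G]]].
Proof.
have b_a : has_nowhere_zero_kflow G 4 -> has_nowhere_zero_flow G.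
  case=> o [xi [oo flow bound]]; exists o, xi; split=> // e.
  by have /andP[] := bound e; rewrite Num.Theory.normr_gt0.
have a_p := flow_odd_pair G_eulerian G_odd.
have p_d := odd_pair_even_cover G_eulerian G_odd.
have d_b := @even_subgraphs_kflow G.
(* Each implication of the cycle passes through a pair of edge-disjoint odd closed trails. *)
tfae.
- by move/a_p/p_d.
- by move/b_a/a_p/odd_pair_circuits.
- by move/circuits_odd_pair/p_d.
- by move/d_b/b_a/a_p/(odd_pair_decomposition G_eulerian G_odd).
(* Euler trails of two of the three subgraphs form such a pair. *)
case=> H1 [H2 [H3 [[e1 e2 _] [o1 o2 _] [dis _ _] _ _]]].
exact/b_a/d_b/p_d/(odd_pair_eulerian e1 e2 o1 o2 dis).
Qed.
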